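(* Let $m,n\ge 2$ be integers and let $\mathcal{A}=(a_{j_1\cdots j_m})$ be a real $m$th order $n$-dimensional tensor. Then the following hold. (a) $\mathcal{D}(\mathcal{A})=\mathcal{D}(\mathrm{sym}(\mathcal{A}))$. (b) If $\mathcal{A}-\mathcal{D}(\mathcal{A})$ is nonnegative (or non-positive, or alternative, or negatively alternative, respectively), then $\mathrm{sym}(\mathcal{A})-\mathcal{D}(\mathrm{sym}(\mathcal{A}))$ is also nonnegative (or non-positive, or alternative, or negatively alternative, respectively). (c) The symmetrization of a Toeplitz tensor is still a Toeplitz tensor. The symmetrization of a circulant tensor is still a circulant tensor. (d) The symmetrization of a circulant $\mathrm{B}_0$ tensor is still a circulant $\mathrm{B}_0$ tensor. The symmetrization of a circulant $\mathrm{B}$ tensor is still a circulant $\mathrm{B}$ tensor. (e) If $\mathcal{A}$ is circulant, then $\lambda_0(\mathcal{A})=\lambda_0(\mathrm{sym}(\mathcal{A}))$. If the associated tensor of a circulant tensor is nonnegative (or non-positive), then the associated tensor of its symmetrization is also nonnegative (or non-positive). (f) If $\mathcal{A}$ is circulant and $m$ and $n$ are even, then $\lambda_{n/2}(\mathcal{A})=\lambda_{n/2}(\mathrm{sym}(\mathcal{A}))$.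
   Context: Write $[n]=\{1,\dots,n\}$. A real $m$th order $n$-dimensional tensor is an array $\mathcal{A}=(a_{j_1\cdots j_m})$ of real numbers indexed by $[n]^m$; it is symmetric if its entries are invariant under all permutations of the indices. For $\mathbf{x}\in\mathbb{R}^n$, $\mathcal{A}\mathbf{x}^m=\sum_{j_1,\dots,j_m=1}^n a_{j_1\cdots j_m}x_{j_1}\cdots x_{j_m}$. The symmetrization $\mathrm{sym}(\mathcal{A})$ is the unique symmetric $m$th order $n$-dimensional tensor $\mathcal{B}$ with $\mathcal{A}\mathbf{x}^m=\mathcal{B}\mathbf{x}^m$ for all $\mathbf{x}\in\mathbb{R}^n$; the entry of $\mathrm{sym}(\mathcal{A})$ at $(j_1,\dots,j_m)$ is the average of the entries of $\mathcal{A}$ over all distinct rearrangements of $(j_1,\dots,j_m)$. $\mathcal{D}(\mathcal{A})$ denotes the diagonal tensor with the same diagonal entries $a_{j\cdots j}$ as $\mathcal{A}$ (all other entries $0$). $\mathcal{A}$ is Toeplitz if $a_{j_1\cdots j_m}=a_{j_1+1\cdots j_m+1}$ for all $j_1,\dots,j_m\in[n-1]$. $\mathcal{A}$ is circulant if $a_{j_1\cdots j_m}=a_{k_1\cdots k_m}$ whenever $j_l,k_l\in[n]$ and $k_l\equiv j_l+1\pmod n$ for all $l\in[m]$. A tensor is nonnegative (non-positive) if all its entries are $\ge0$ ($\le 0$). A tensor $\mathcal{B}=(b_{j_1\cdots j_m})$ is alternative if $b_{j_1\cdots j_m}(-1)^{j_1+\cdots+j_m-m}\ge0$ for all indices, and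 negatively alternative if $-\mathcal{B}$ is alternative. $\mathcal{A}$ is a $\mathrm{B}_0$ tensor if for every $j\in[n]$: $\sum_{j_2,\dots,j_m=1}^n a_{jj_2\cdots j_m}\ge0$, and $\frac1{n^{m-1}}\sum_{j_2,\dots,j_m=1}^n a_{jj_2\cdots j_m}\ge a_{jk_2\cdots k_m}$ for all $(k_2,\dots,k_m)\neq(j,\dots,j)$. It is a $\mathrm{B}$ tensor if all these inequalities are strict. For a circulant tensor $\mathcal{A}$, the root tensor is the order $m-1$ tensor $(\alpha_{j_1\cdots j_{m-1}})$ with $\alpha_{j_1\cdots j_{m-1}}=a_{1j_1\cdots j_{m-1}}$; the associated tensor is obtained from it by replacing $\alpha_{1\cdots1}$ by $0$; and $\lambda_0(\mathcal{A})=\sum_{j_1,\dots,j_{m-1}=1}^n\alpha_{j_1\cdots j_{m-1}}$, and, for even $n$, $\lambda_{n/2}(\mathcal{A})=\sum_{j_1,\dots,j_{m-1}=1}^n\alpha_{j_1\cdots j_{m-1}}(-1)^{j_1+\cdots+j_{m-1}-m+1}$. *)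

(* Defs.v *)
From mathcomp Require Import all_boot all_order all_fingroup all_algebra.

Set Implicit Arguments.
Unset Strict Implicit.
Unset Printing Implicit Defensive.

Import Order.TTheory GRing.Theory Num.Theory.
Local Open Scope ring_scope.

(* [n] is modelled by 'I_n, so i : 'I_n stands for the index i + 1. *)
Notation tensor R m n := {ffun m.-tuple 'I_n -> R}.

Section Tensors.
Variable R : realFieldType.
Implicit Types m n : nat.

Definition symmetric_tensor m n (A : tensor R m n) : Prop :=
  forall (s : 'S_m) (j : m.-tuple 'I_n), A [tuple tnth j (s l) | l < m] = A j.

Definition tensor_form m n (A : tensor R m n) (x : 'rV[R]_n) : R :=
  \sum_(j : m.-tuple 'I_n) A j * \prod_(l < m) x 0 (tnth j l).

(* The k satisfying perm_eq k j are the distinct rearrangements of j; symP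
   below shows that sym A is the unique symmetric tensor with the same form
   as A. *)
Definition sym m n (A : tensor R m n) : tensor R m n :=
  [ffun j : m.-tuple 'I_n =>
     (\sum_(k : m.-tuple 'I_n | perm_eq k j) A k)
       / #|[set k : m.-tuple 'I_n | perm_eq k j]|%:R].

Definition diag_part m n (A : tensor R m n) : tensor R m n :=
  [ffun j : m.-tuple 'I_n => if constant j then A j else 0].

Definition Toeplitz m n (A : tensor R m n) : Prop :=
  forall j k : m.-tuple 'I_n,
    (forall l, nat_of_ord (tnth k l) = (tnth j l).+1) -> A j = A k.

Definition circulant m n (A : tensor R m n) : Prop :=
  forall j k : m.-tuple 'I_n,
    (forall l, tnth k l = (tnth j l).+1 %[mod n]) -> A j = A k.

Definition nonneg_tensor m n (A : tensor R m n) : Prop := forall j, 0 <= A j.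

Definition nonpos_tensor m n (A : tensor R m n) : Prop := forall j, A j <= 0.

(* With one-based indices, (j_1 - 1) + ... + (j_m - 1) = j_1 + ... + j_m - m. *)
Definition alt_sign m n (j : m.-tuple 'I_n) : R :=
  (-1) ^+ (\sum_(l < m) tnth j l)%N.

Definition alternative m n (A : tensor R m n) : Prop :=
  forall j, 0 <= A j * alt_sign j.

Definition neg_alternative m n (A : tensor R m n) : Prop := alternative (- A).

Definition row_sum m n (A : tensor R m.+1 n) (j : 'I_n) : R :=
  \sum_(k : m.-tuple 'I_n) A (cons_tuple j k).

(* Here the order is m.+1, whence the exponent m in the average. *)
Definition B0_tensor m n (A : tensor R m.+1 n) : Prop :=
  forall j : 'I_n,
    0 <= row_sum A j /\
    (forall k : m.-tuple 'I_n, k != nseq_tuple m j ->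
       A (cons_tuple j k) <= (n%:R ^+ m)^-1 * row_sum A j).

Definition B_tensor m n (A : tensor R m.+1 n) : Prop :=
  forall j : 'I_n,
    0 < row_sum A j /\
    (forall k : m.-tuple 'I_n, k != nseq_tuple m j ->
       A (cons_tuple j k) < (n%:R ^+ m)^-1 * row_sum A j).

Definition root_tensor m n (A : tensor R m.+1 n.+1) : tensor R m n.+1 :=
  [ffun k : m.-tuple 'I_n.+1 => A (cons_tuple ord0 k)].

Definition assoc_tensor m n (A : tensor R m.+1 n.+1) : tensor R m n.+1 :=
  [ffun k : m.-tuple 'I_n.+1 =>
     if k == nseq_tuple m ord0 then 0 else root_tensor A k].

Definition lambda0 m n (A : tensor R m.+1 n.+1) : R :=
  \sum_(k : m.-tuple 'I_n.+1) root_tensor A k.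

(* lambda_{n/2}; only meaningful when the dimension n.+1 is even. *)
Definition lambda_half m n (A : tensor R m.+1 n.+1) : R :=
  \sum_(k : m.-tuple 'I_n.+1) root_tensor A k * alt_sign k.

Lemma symmetric_tensorP m n (A : tensor R m n) :
  symmetric_tensor A <->
  (forall j k : m.-tuple 'I_n, perm_eq j k -> A j = A k).
Proof.
split=> [sA j k /tuple_permP[s e] | sA s j].
  by rewrite -(sA s k); have -> : j = [tuple tnth k (s l) | l < m] by apply: val_inj.
by apply: sA; apply/tuple_permP; exists s.
Qed.

Lemma card_rearr_gt0 m n (j : m.-tuple 'I_n) :
  (0 < #|[set k : m.-tuple 'I_n | perm_eq k j]|)%N.
Proof. by apply/card_gt0P; exists j; rewrite inE perm_refl. Qed.

Lemma card_rearr m n (j k : m.-tuple 'I_n) : perm_eq j k ->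
  #|[set i : m.-tuple 'I_n | perm_eq i j]| =
  #|[set i : m.-tuple 'I_n | perm_eq i k]|.
Proof. by move=> /permPr e; apply: eq_card => i; rewrite !inE e. Qed.

Lemma sym_symmetric m n (A : tensor R m n) : symmetric_tensor (sym A).
Proof.
apply/symmetric_tensorP => j k jk; rewrite !ffunE (card_rearr jk).
by congr (_ / _); apply: eq_bigl => i; rewrite (permPr jk).
Qed.

Lemma tensor_form_sym m n (A : tensor R m n) x :
  tensor_form (sym A) x = tensor_form A x.
Proof.
pose F (j : m.-tuple 'I_n) := \prod_(i <- j) x 0 i.
have FE (B : tensor R m n) : tensor_form B x = \sum_j B j * F j.
  by apply: eq_bigr => j _; rewrite /F big_tuple.
rewrite !FE.
under eq_bigr => j _ do rewrite ffunE -mulrA mulr_suml.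
rewrite (exchange_big_dep predT) //=; apply: eq_bigr => k _.
pose c : R := #|[set i : m.-tuple 'I_n | perm_eq i k]|%:R.
rewrite (eq_bigr (fun=> A k * (c^-1 * F k))); last first.
  move=> j kj; rewrite /c (card_rearr kj); congr (_ * (_ * _)).
  by rewrite /F; apply: perm_big; rewrite perm_sym.
rewrite (eq_bigl (mem [set i : m.-tuple 'I_n | perm_eq i k])); last first.
  by move=> j; rewrite /= inE perm_sym.
rewrite sumr_const -mulr_natr -/c -mulrA; congr (_ * _).
rewrite mulrAC mulVf ?mul1r// /c pnatr_eq0.
by rewrite -lt0n card_rearr_gt0.
Qed.

Lemma digits_inj N n (c d : nat -> nat) :
  (forall i, c i < N)%N -> (forall i, d i < N)%N ->
  (\sum_(i < n) c i * N ^ i = \sum_(i < n) d i * N ^ i)%N ->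
  forall i, (i < n)%N -> c i = d i.
Proof.
elim: n c d => // n IH c d cN dN; rewrite !big_ord_recl /= !expn0 !muln1.
have shift f : (\sum_(i < n) f (bump 0 i) * N ^ bump 0 i
    = (\sum_(i < n) f i.+1 * N ^ i) * N)%N.
  by rewrite big_distrl; apply: eq_bigr => i _; rewrite expnSr mulnA.
rewrite !shift => e.
have N0 : (0 < N)%N by apply: leq_ltn_trans (cN 0%N).
have e0 : c 0%N = d 0%N.
  by move/(congr1 (modn^~ N)): e; rewrite ![(_ + _ * N)%N]addnC !modnMDl !modn_small.
move: e; rewrite e0 => /addnI /eqP; rewrite eqn_pmul2r// => /eqP e.
by case=> [//|i] ?; apply: (IH (fun i => c i.+1) (fun i => d i.+1)).
Qed.

Definition mexp N n (s : seq 'I_n) := (\sum_(i <- s) N ^ i)%N.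

Lemma mexpE N n (s : seq 'I_n) :
  mexp N s = (\sum_(i < n) count_mem i s * N ^ i)%N.
Proof.
rewrite /mexp; elim: s => [|a s IH]; first by rewrite big_nil big1.
rewrite big_cons IH /=.
under [RHS]eq_bigr => i _ do rewrite mulnDl.
rewrite big_split /=; congr (_ + _)%N.
rewrite (bigD1 a) //= eqxx mul1n big1 ?addn0// => i.
by rewrite eq_sym => /negPf->.
Qed.

Lemma mexp_inj m n (j k : m.-tuple 'I_n) :
  mexp m.+1 j = mexp m.+1 k -> perm_eq j k.
Proof.
case: n j k => [|n] j k.
  case: m j k => [|m] j k _; last by case: (thead j).
  by rewrite (tuple0 j) (tuple0 k).
rewrite !mexpE => e; apply/allP => i _ /=; apply/eqP.
pose C (s : m.-tuple 'I_n.+1) l := count_mem (inord l : 'I_n.+1) s.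
have Cm s l : (C s l < m.+1)%N by rewrite ltnS -[leqRHS](size_tuple s) count_size.
have := @digits_inj m.+1 n.+1 (C j) (C k) (Cm j) (Cm k) _ i (ltn_ord i).
rewrite /C inord_val; apply.
under eq_bigr => l _ do rewrite inord_val.
by rewrite e; apply: eq_bigr => l _; rewrite inord_val.
Qed.

Lemma poly_eval0 (p : {poly R}) : (forall t, p.[t] = 0) -> p = 0.
Proof.
move=> p0; apply/eqP; apply: contraT => pn0.
have := @max_poly_roots _ p [seq i%:R | i <- iota 0 (size p)] pn0.
rewrite size_map size_iota ltnn; apply.
  by apply/allP => t _; rewrite /root p0.
by rewrite map_inj_uniq ?iota_uniq// => a b /eqP; rewrite eqr_nat => /eqP.
Qed.

Lemma tensor_form_inj m n (A B : tensor R m n) :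
  symmetric_tensor A -> symmetric_tensor B ->
  (forall x, tensor_form A x = tensor_form B x) -> A = B.
Proof.
move=> /symmetric_tensorP sA /symmetric_tensorP sB AB.
pose p := \sum_(j : m.-tuple 'I_n) (A j - B j) *: 'X^(mexp m.+1 j).
have p0 : p = 0.
  apply: poly_eval0 => t.
  have := AB (\row_i t ^+ (m.+1 ^ i)%N).
  move/eqP; rewrite -subr_eq0 /tensor_form -sumrB => /eqP e.
  rewrite -[RHS]e /p horner_sum; apply: eq_bigr => j _.
  rewrite hornerZ hornerXn -mulrBl /mexp big_tuple -prodrXr.
  by congr (_ * _); apply: eq_bigr => l _; rewrite mxE.
apply/ffunP => j; apply/eqP; rewrite -subr_eq0.
have := congr1 (fun q : {poly R} => q`_(mexp m.+1 j)) p0.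
rewrite coef0 coef_sum.
under eq_bigr => k _ do rewrite coefZ coefXn.
rewrite (bigID (mem [set k : m.-tuple 'I_n | perm_eq k j])) /=.
rewrite [X in _ + X]big1 ?addr0; last first.
  move=> k; rewrite inE => nkj.
  have [/esym/mexp_inj|_] := eqVneq; last by rewrite mulr0.
  by rewrite (negPf nkj).
rewrite (eq_bigr (fun=> A j - B j)).
  move=> /eqP; rewrite sumr_const mulrn_eq0 => /orP[|//].
  by rewrite eqn0Ngt card_rearr_gt0.
move=> k; rewrite inE => kj.
have -> : mexp m.+1 k = mexp m.+1 j by apply: perm_big.
by rewrite eqxx mulr1 (sA _ _ kj) (sB _ _ kj).
Qed.

Lemma symP m n (A B : tensor R m n) :
  B = sym A <->
  symmetric_tensor B /\ (forall x, tensor_form A x = tensor_form B x).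
Proof.
split=> [-> | [sB AB]].
  by split=> [|x]; [apply: sym_symmetric | rewrite tensor_form_sym].
by apply: tensor_form_inj => // [|x]; [apply: sym_symmetric | rewrite tensor_form_sym].
Qed.

End Tensors.

(* Main.v *)
(* Both the positions and the index shift i |-> i + 1 (mod n) act on index
   tuples, and these actions commute, so symmetrization preserves Toeplitz and
   circulant tensors. If A is circulant and x (i + 1) = c * x i with
   c ^ m = 1, then every slice of the form A x ^ m contributes equally, so
   A x ^ m is n times the slice of the index 1. Symmetrization does not change
   the form; x = 1 gives lambda_0 and x_i = (-1) ^ (i - 1) gives
   lambda_(n/2), where c = -1 is consistent with the wrap-around because n is
   even, and c ^ m = 1 because m is even. *)

Require Import Defs.
From mathcomp Require Import all_boot all_order all_fingroup all_algebra.
From mathcomp Require Import reals.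

Import Order.TTheory GRing.Theory Num.Theory.
Local Open Scope ring_scope.

(** * Rearrangements, constant tuples and shifted tuples *)

Lemma perm_constant {T : eqType} {s t : seq T} :
  perm_eq s t -> constant s = constant t.
Proof.
have imp (u v : seq T) : perm_eq u v -> constant u -> constant v.
  case: u => [|x u] uv; first by move: uv; rewrite perm_sym => /perm_nilP->.
  move=> cu; apply: (@all_pred1_constant _ x).
  by rewrite -(perm_all _ uv) /= eqxx.
by move=> st; apply/idP/idP; apply: imp; rewrite // perm_sym.
Qed.

(** Averaging at a diagonal index has a single term for this reason, which is why symmetrization
    fixes the diagonal. *)
Lemma perm_constant_eq {T : eqType} {s t : seq T} :
  perm_eq s t -> constant t -> s = t.
Proof.
move=> st ct; have cs : constant s by rewrite (perm_constant st).
case: t s st ct cs => [|y t] [|x s] st ct cs; rewrite ?(perm_nilP st) //.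
  by move/perm_size: st.
have yx : y = x.
  have : y \in x :: s by rewrite (perm_mem st) mem_head.
  by rewrite inE => /orP[/eqP //|/(allP cs)/eqP].
have [sz] := perm_size st; subst y.
by rewrite (all_pred1P _ _ cs) (all_pred1P _ _ ct) sz.
Qed.

(** Links the diagonal test of [diag_part] with the test on tails used for B tensors and associated
    tensors. *)
Lemma constant_cons_tuple {T : eqType} {m : nat} (x : T) (k : m.-tuple T) :
  constant (cons_tuple x k) = (k == nseq_tuple m x).
Proof.
rewrite -val_eqE /=; apply/all_pred1P/eqP => ->; first by rewrite size_tuple.
by rewrite size_nseq.
Qed.

Lemma map_cons_tuple {T U : Type} {m : nat} (f : T -> U) (x : T)
    (k : m.-tuple T) :
  map_tuple f (cons_tuple x k) = cons_tuple (f x) (map_tuple f k).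
Proof. exact: val_inj. Qed.

Lemma cons_tuple_eta {T : Type} {m : nat} (j : m.+1.-tuple T) :
  j = cons_tuple (thead j) (behead_tuple j).
Proof. by rewrite [LHS]tuple_eta; apply: val_inj. Qed.

Lemma map_tuple_inj {T U : eqType} {m : nat} (f : T -> U) :
  injective f -> injective (map_tuple f : m.-tuple T -> m.-tuple U).
Proof.
by move=> f_inj u v /(congr1 val) /= /(inj_map f_inj) uv; apply: val_inj.
Qed.

Lemma big_tuple_cons {V : nmodType} {T : finType} {m : nat}
    (F : m.+1.-tuple T -> V) :
  \sum_j F j = \sum_x \sum_(k : m.-tuple T) F (cons_tuple x k).
Proof.
rewrite pair_bigA (reindex (fun p : T * m.-tuple T => cons_tuple p.1 p.2)) //=.
exists (fun j => (thead j, behead_tuple j)) => [[x k] _|j _] /=.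
  by congr (_, _); apply: val_inj.
by rewrite -cons_tuple_eta.
Qed.

(** * Symmetrization as an average: diagonal, signs and relabelling *)

Section Symmetrization.
Context {R : realFieldType} {m n : nat}.
Implicit Types (A B : tensor R m n) (j k : m.-tuple 'I_n).

Lemma symM_card A j :
  sym A j * #|[set k : m.-tuple 'I_n | perm_eq k j]|%:R
    = \sum_(k : m.-tuple 'I_n | perm_eq k j) A k.
Proof. by rewrite ffunE divfK// pnatr_eq0 -lt0n card_rearr_gt0. Qed.

(** An average cannot exceed all of its terms. Both the sign statements and the B-type inequalities
    rest on this bound. *)
Lemma sym_le_rearr A j :
  exists2 k : m.-tuple 'I_n, perm_eq k j & sym A j <= A k.
Proof.
have [|none] :=
    boolP [exists k : m.-tuple 'I_n, perm_eq k j && (sym A j <= A k)].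
  by case/existsP=> k /andP[]; exists k.
suff : \sum_(k : m.-tuple 'I_n | perm_eq k j) A k
    < \sum_(k : m.-tuple 'I_n | perm_eq k j) sym A j.
  by rewrite -symM_card sumr_const mulr_natr cardsE ltxx.
apply: ltr_sum => [|k kj].
  by apply/hasP; exists j; rewrite ?mem_index_enum.
rewrite ltNge; apply: contra none => le_j.
by apply/existsP; exists k; rewrite kj.
Qed.

Lemma symB A B : sym (A - B) = sym A - sym B.
Proof.
apply/ffunP=> j; rewrite !ffunE -mulrBl -sumrB.
by congr (_ / _); apply: eq_bigr => k _; rewrite !ffunE.
Qed.

Lemma symN A : sym (- A) = - sym A.
Proof.
apply/ffunP=> j; rewrite !ffunE -mulNr -sumrN.
by congr (_ / _); apply: eq_bigr => k _; rewrite !ffunE.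
Qed.

Lemma sym_id A : symmetric_tensor A -> sym A = A.
Proof. by move=> sA; apply/esym/symP. Qed.

Lemma diag_part_symmetric A : symmetric_tensor (diag_part A).
Proof.
apply/symmetric_tensorP=> j k jk; rewrite !ffunE (perm_constant jk).
by case: ifP => // ck; congr (A _); apply/val_inj/(perm_constant_eq jk).
Qed.

Lemma diag_part_sym A : diag_part (sym A) = diag_part A.
Proof.
apply/ffunP=> j; rewrite !ffunE; case: ifP => // cj.
rewrite (bigD1 j) ?perm_refl //= big1 ?addr0.
  have -> : [set k : m.-tuple 'I_n | perm_eq k j] = [set j].
    apply/setP=> k; rewrite !inE.
    apply/idP/eqP => [kj|->]; last exact: perm_refl.
    exact/val_inj/(perm_constant_eq kj).
  by rewrite cards1 divr1.
by move=> k /andP[kj /eqP[]]; apply/val_inj/(perm_constant_eq kj).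
Qed.

(** Symmetrization is additive and fixes the symmetric tensor [diag_part A]. This reduces (b) to
    sign preservation by [sym]. *)
Lemma sym_sub_diag A : sym A - diag_part (sym A) = sym (A - diag_part A).
Proof. by rewrite symB diag_part_sym (sym_id _ (diag_part_symmetric A)). Qed.

Lemma sub_diagE A j :
  (A - diag_part A) j = if constant j then 0 else A j.
Proof. by rewrite !ffunE; case: ifP => _; rewrite ?subrr ?subr0. Qed.

Lemma nonpos_sym A : nonpos_tensor A -> nonpos_tensor (sym A).
Proof. by move=> A0 j; have [k _ /le_trans] := sym_le_rearr A j; apply. Qed.

Lemma nonneg_sym A : nonneg_tensor A -> nonneg_tensor (sym A).
Proof.
move=> A0 j; have := @nonpos_sym (- A) _ j.
by rewrite symN ffunE oppr_le0; apply=> k; rewrite ffunE oppr_le0.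
Qed.

Lemma perm_alt_sign j k : perm_eq j k -> alt_sign R j = alt_sign R k.
Proof.
move=> jk; rewrite /alt_sign; congr (_ ^+ _).
have sumE (s : m.-tuple 'I_n) :
    (\sum_(l < m) tnth s l = \sum_(i <- s) nat_of_ord i)%N by rewrite big_tuple.
by rewrite !sumE; apply: perm_big.
Qed.

(** The sign depends only on the sum of the indices, so it is constant on each rearrangement class
    and can be moved inside the average; the nonnegative case then applies. *)
Lemma alternative_sym A : alternative A -> alternative (sym A).
Proof.
move=> A0 j; pose B : tensor R m n := [ffun k => A k * alt_sign R k].
suff -> : sym A j * alt_sign R j = sym B j.
  by apply: nonneg_sym => k; rewrite ffunE.
rewrite !ffunE mulrAC mulr_suml; congr (_ / _); apply: eq_bigr => k kj.
by rewrite ffunE (perm_alt_sign _ _ kj).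
Qed.

(** Relabelling by [f] maps the rearrangements of [j] bijectively onto those of its image, so the
    two averages agree term by term. The hypothesis is restricted to rearrangements of [j] because
    the Toeplitz condition says nothing about shifts that wrap around. *)
Lemma sym_map_tuple A B (f : 'I_n -> 'I_n) j : injective f ->
  (forall k : m.-tuple 'I_n, perm_eq k j -> A k = B (map_tuple f k)) ->
  sym A j = sym B (map_tuple f j).
Proof.
move=> f_inj AB; have fT_inj := @map_tuple_inj _ _ m f f_inj.
have permf k : perm_eq (map_tuple f k) (map_tuple f j) = perm_eq k j.
  by apply/idP/idP => [|kj]; [exact: perm_map_inj | exact: perm_map].
rewrite !ffunE [X in _ = X / _](reindex_inj fT_inj) /=; congr (_ / _).
  by apply: eq_big => k; [rewrite permf | move/AB].
rewrite -(card_imset _ fT_inj); congr (_%:R); apply: eq_card => k.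
apply/imsetP/idP => [[i]|]; rewrite !inE; first by rewrite -permf => ij ->.
(* An injective self-map of a finite set is bijective; its inverse supplies the preimage of [k]. *)
have [g gK Kg] := injF_bij f_inj => kj.
have fgk : map_tuple f (map_tuple g k) = k.
  by apply: val_inj; rewrite /= -map_comp map_id_in // => i _; apply: Kg.
by exists (map_tuple g k) => //; rewrite inE -permf fgk.
Qed.

End Symmetrization.

(** * Circulant and Toeplitz tensors under the cyclic shift *)

Lemma circulantP {R : realFieldType} {m n : nat} (A : tensor R m n) :
  circulant A <-> forall j, A (map_tuple (@ordS n) j) = A j.
Proof.
split=> [cA j | cA j k jk].
  by apply/esym/cA => l; rewrite tnth_map modn_mod.
rewrite -cA; congr (A _); apply/eq_from_tnth => l; rewrite tnth_map.
by apply: val_inj; rewrite /= -jk modn_small.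
Qed.

Lemma circulant_sym {R : realFieldType} {m n : nat} (A : tensor R m n) :
  circulant A -> circulant (sym A).
Proof.
move=> /circulantP cA; apply/circulantP => j.
by apply/esym/sym_map_tuple => [|k _]; [apply: ordS_inj | rewrite cA].
Qed.

Lemma Toeplitz_sym {R : realFieldType} {m n : nat} (A : tensor R m n) :
  Toeplitz A -> Toeplitz (sym A).
Proof.
move=> tA j k jk.
(* The successor of each entry of [j] is an entry of [k], hence below [n]: the cyclic shift does not
   wrap on [j]. *)
have sE (l : 'I_m) : (tnth j l).+1 = ordS (tnth j l) :> nat.
  by rewrite /= modn_small // -jk.
have -> : k = map_tuple (@ordS n) j.
  by apply/eq_from_tnth => l; rewrite tnth_map; apply: ord_inj; rewrite jk sE.
apply: sym_map_tuple => [|i ij]; first exact: ordS_inj.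
apply: tA => l; rewrite tnth_map.
(* A rearrangement has the same entries as [j], so the shift does not wrap on it either. *)
have /tnthP[l' ->] : tnth i l \in j by rewrite -(perm_mem ij) mem_tnth.
by rewrite -sE.
Qed.

Lemma circulant_sub_diag {R : realFieldType} {m n : nat} (A : tensor R m n) :
  circulant A -> circulant (A - diag_part A).
Proof.
move=> /circulantP cA; apply/circulantP => j; rewrite !sub_diagE cA.
congr (if _ then _ else _); case: j => -[|x s] //= _.
by rewrite all_map; apply: eq_all => i /=; rewrite (inj_eq (@ordS_inj n)).
Qed.

(** Below the last index the cyclic successor is the ordinary one, so every index is reached from
    [ord0] without wrapping. *)
Lemma ordS_ind {n : nat} (P : 'I_n.+1 -> Prop) :
  P ord0 -> (forall i, P i -> P (ordS i)) -> forall i, P i.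
Proof.
move=> P0 PS [i]; elim: i => [|i IH] lt_i.
  by rewrite (_ : Ordinal lt_i = ord0) //; apply: val_inj.
have /PS := IH (ltnW lt_i); congr P.
by apply: val_inj; rewrite /= modn_small.
Qed.

(** * Root tensors, slices and row sums of circulant tensors *)

Section Circulant.
Context {R : realFieldType} {m n : nat}.
Implicit Types A : tensor R m.+1 n.+1.

Lemma circulant_root A j : circulant A ->
  exists k : m.-tuple 'I_n.+1, A j = root_tensor A k.
Proof.
move=> /circulantP cA.
suff gen i (k : m.-tuple 'I_n.+1) :
    exists k', A (cons_tuple i k) = root_tensor A k'.
  by rewrite [j]cons_tuple_eta.
move: i k; apply: ordS_ind => [|i IH] k; first by exists k; rewrite ffunE.
(* The tail is shifted back together with the leading index; shifting the whole tuple forward again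
   recovers the entry. *)
have [k' e] := IH (map_tuple (@ord_pred _) k); exists k'.
rewrite -e -[in RHS]cA map_cons_tuple; congr (A (cons_tuple _ _)).
apply: val_inj; rewrite /= -map_comp map_id_in // => l _; exact: ord_predK.
Qed.

(** With leading index [ord0], the only diagonal position is the all-[ord0] tail. *)
Lemma assoc_tensorE A : assoc_tensor A = root_tensor (A - diag_part A).
Proof.
by apply/ffunP=> k; rewrite [RHS]ffunE sub_diagE constant_cons_tuple !ffunE.
Qed.

(** Every entry of a circulant tensor is an entry of its root tensor. This turns the sign claims of
    (e) into those of (b). *)
Lemma assoc_tensorP A (P : R -> Prop) : circulant A ->
  (forall k, P (assoc_tensor A k)) <-> (forall j, P ((A - diag_part A) j)).
Proof.
move=> cA; rewrite assoc_tensorE; split=> PA j.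
  by have [k ->] := circulant_root _ j (circulant_sub_diag _ cA).
by rewrite ffunE.
Qed.

Lemma circulant_slice A (x : 'I_n.+1 -> R) (c : R) (i : 'I_n.+1) :
  circulant A -> (forall l, x (ordS l) = c * x l) -> c ^+ m.+1 = 1 ->
  x i * (\sum_(k : m.-tuple 'I_n.+1) A (cons_tuple i k) * \prod_(l <- k) x l)
  = x ord0 *
      \sum_(k : m.-tuple 'I_n.+1) root_tensor A k * \prod_(l <- k) x l.
Proof.
move=> /circulantP cA xS c1; move: i; apply: ordS_ind => [|i <-].
  by congr (_ * _); apply: eq_bigr => k _; rewrite ffunE.
rewrite (reindex_inj (map_tuple_inj _ (@ordS_inj _))) xS !mulr_sumr.
apply: eq_bigr => k _.
(* The shifted tail contributes [c ^+ m], and the leading variable one more factor [c], for a total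
   of [c ^+ m.+1 = 1]. *)
have -> : \prod_(l <- map_tuple (@ordS _) k) x l = c ^+ m * \prod_(l <- k) x l.
  rewrite big_map; under eq_bigr => l _ do rewrite xS.
  by rewrite big_split /= big_const_seq count_predT size_tuple iter_mulr_1.
rewrite -map_cons_tuple cA.
by rewrite -mulrA (mulrCA (A _)) (mulrCA (x i)) [c * _]mulrA -exprS c1 mul1r.
Qed.

Lemma tensor_form_circulant A (x : 'rV[R]_n.+1) (c : R) :
  circulant A -> (forall l, x 0 (ordS l) = c * x 0 l) -> c ^+ m.+1 = 1 ->
  tensor_form A x = n.+1%:R * (x 0 0 *
    \sum_(k : m.-tuple 'I_n.+1) root_tensor A k * \prod_(l < m) x 0 (tnth k l)).
Proof.
move=> cA xS c1; rewrite /tensor_form big_tuple_cons.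
under [in RHS]eq_bigr => k _ do rewrite -(big_tuple _ _ k xpredT (x 0)).
rewrite mulr_natl -[X in _ *+ X](card_ord n.+1) -sumr_const.
apply: eq_bigr => i _.
rewrite -(circulant_slice A (x 0) c i cA xS c1) mulr_sumr.
apply: eq_bigr => k _; rewrite -(big_tuple _ _ (cons_tuple i k) xpredT (x 0)).
by rewrite big_cons mulrCA.
Qed.

Lemma row_sum_circulant A (i : 'I_n.+1) :
  circulant A -> row_sum A i = lambda0 A.
Proof.
move=> cA; have := circulant_slice A (fun=> 1) 1 i cA.
rewrite mulr1 expr1n !mul1r => /(_ (fun=> erefl) erefl).
by under eq_bigr do rewrite big1_eq mulr1;
   under [in RHS]eq_bigr do rewrite big1_eq mulr1.
Qed.

(** Both forms equal [n.+1] times their first slice, and the forms agree, so the nonzero factor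
    [n.+1] cancels. *)
Lemma circulant_slice_sym A (x : 'rV[R]_n.+1) (c : R) :
  circulant A -> (forall l, x 0 (ordS l) = c * x 0 l) -> c ^+ m.+1 = 1 ->
  x 0 0 = 1 ->
  \sum_(k : m.-tuple 'I_n.+1) root_tensor A k * \prod_(l < m) x 0 (tnth k l) =
  \sum_(k : m.-tuple 'I_n.+1)
     root_tensor (sym A) k * \prod_(l < m) x 0 (tnth k l).
Proof.
move=> cA xS c1 x0; have := tensor_form_sym A x.
rewrite !(tensor_form_circulant _ x c) ?x0 ?mul1r //; last exact: circulant_sym.
by move/mulfI => ->; rewrite ?pnatr_eq0.
Qed.

Lemma lambda0_sym A : circulant A -> lambda0 A = lambda0 (sym A).
Proof.
move=> cA; have lambda0E B : lambda0 B = \sum_(k : m.-tuple 'I_n.+1)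
    root_tensor B k * \prod_(l < m) (const_mx 1 : 'rV[R]_n.+1) 0 (tnth k l).
  apply: eq_bigr => k _; rewrite big1 ?mulr1 // => l _; exact: mxE.
rewrite !lambda0E; apply: (circulant_slice_sym A _ 1 cA) => [l||].
- by rewrite !mxE mul1r.
- exact: expr1n.
- exact: mxE.
Qed.

Lemma lambda_half_sym A : circulant A -> ~~ odd m.+1 -> ~~ odd n.+1 ->
  lambda_half A = lambda_half (sym A).
Proof.
move=> cA m_even n_even; pose x : 'rV[R]_n.+1 := \row_i (-1) ^+ i.
have lambda_halfE B : lambda_half B =
    \sum_(k : m.-tuple 'I_n.+1) root_tensor B k * \prod_(l < m) x 0 (tnth k l).
  apply: eq_bigr => k _; congr (_ * _); rewrite /alt_sign -prodrXr.
  by apply: eq_bigr => l _; rewrite mxE.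
rewrite !lambda_halfE; apply: (circulant_slice_sym A x (-1) cA) => [l||].
(* Reduction modulo the even number [n.+1] preserves parity, so the alternating sign flips even
   where the shift wraps around. *)
- rewrite !mxE -exprS -[LHS]signr_odd -[RHS]signr_odd.
  congr (_ ^+ nat_of_bool _).
  by rewrite [in RHS](divn_eq l.+1 n.+1) oddD oddM (negPf n_even) andbF.
- by rewrite -signr_odd (negPf m_even).
- by rewrite mxE.
Qed.

(** A rearrangement of an off-diagonal index is off-diagonal, but it may start with another index,
    so the bounding entry may lie in a different row. *)
Lemma sym_cons_le A (i : 'I_n.+1) (k : m.-tuple 'I_n.+1) :
  k != nseq_tuple m i -> exists i' k', k' != nseq_tuple m i' /\
    sym A (cons_tuple i k) <= A (cons_tuple i' k').
Proof.
rewrite -constant_cons_tuple => ck.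
have [j jk le_j] := sym_le_rearr A (cons_tuple i k).
exists (thead j), (behead_tuple j).
by rewrite -constant_cons_tuple -cons_tuple_eta (perm_constant jk).
Qed.

(** All row sums equal the common [lambda0]. Two independent rows are allowed so that the B-type
    bound of row [i'] can be used for row [i] of the symmetrization. *)
Lemma row_sum_sym A (i i' : 'I_n.+1) :
  circulant A -> row_sum (sym A) i = row_sum A i'.
Proof.
move=> cA; rewrite (row_sum_circulant _ _ cA) (lambda0_sym _ cA).
by apply/row_sum_circulant/circulant_sym.
Qed.

Lemma B0_tensor_sym A : circulant A -> B0_tensor A -> B0_tensor (sym A).
Proof.
move=> cA bA i; split=> [|k /(sym_cons_le A)[i' [k' [nk']]]].
  by rewrite (row_sum_sym _ _ i cA); have [] := bA i.
move=> /le_trans; apply; rewrite (row_sum_sym _ _ i' cA).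
exact: (bA i').2.
Qed.

Lemma B_tensor_sym A : circulant A -> B_tensor A -> B_tensor (sym A).
Proof.
move=> cA bA i; split=> [|k /(sym_cons_le A)[i' [k' [nk']]]].
  by rewrite (row_sum_sym _ _ i cA); have [] := bA i.
move=> /le_lt_trans; apply; rewrite (row_sum_sym _ _ i' cA).
exact: (bA i').2.
Qed.

End Circulant.

Theorem theorem4 (R : realType) (m n : nat) (A : tensor R m.+2 n.+2) :
  (* (a) *)
  diag_part A = diag_part (sym A) /\
  (* (b) *)
  ((nonneg_tensor (A - diag_part A) ->
      nonneg_tensor (sym A - diag_part (sym A))) /\
   (nonpos_tensor (A - diag_part A) ->
      nonpos_tensor (sym A - diag_part (sym A))) /\
   (alternative (A - diag_part A) ->
      alternative (sym A - diag_part (sym A))) /\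
   (neg_alternative (A - diag_part A) ->
      neg_alternative (sym A - diag_part (sym A)))) /\
  (* (c) *)
  ((Toeplitz A -> Toeplitz (sym A)) /\
   (circulant A -> circulant (sym A))) /\
  (* (d) *)
  ((circulant A /\ B0_tensor A -> circulant (sym A) /\ B0_tensor (sym A)) /\
   (circulant A /\ B_tensor A -> circulant (sym A) /\ B_tensor (sym A))) /\
  (* (e) *)
  ((circulant A -> lambda0 A = lambda0 (sym A)) /\
   (circulant A -> nonneg_tensor (assoc_tensor A) ->
      nonneg_tensor (assoc_tensor (sym A))) /\
   (circulant A -> nonpos_tensor (assoc_tensor A) ->
      nonpos_tensor (assoc_tensor (sym A)))) /\
  (* (f) *)
  (circulant A -> ~~ odd m.+2 -> ~~ odd n.+2 ->
     lambda_half A = lambda_half (sym A)).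
Proof.
split; first by rewrite diag_part_sym.
split.
  rewrite sym_sub_diag; split; first exact: nonneg_sym.
  split; first exact: nonpos_sym.
  split; first exact: alternative_sym.
  by rewrite /neg_alternative -symN; apply: alternative_sym.
split; first by split; [apply: Toeplitz_sym | apply: circulant_sym].
split.
  split=> -[cA bA]; split; try exact: circulant_sym.
    exact: B0_tensor_sym.
  exact: B_tensor_sym.
split; last exact: lambda_half_sym.
split; first exact: lambda0_sym.
split=> cA.
  move/(assoc_tensorP _ (fun a => 0 <= a) cA) => A0.
  apply/(assoc_tensorP _ (fun a => 0 <= a) (circulant_sym _ cA)).
  by rewrite sym_sub_diag; apply: nonneg_sym.
move/(assoc_tensorP _ (fun a => a <= 0) cA) => A0.
apply/(assoc_tensorP _ (fun a => a <= 0) (circulant_sym _ cA)).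
by rewrite sym_sub_diag; apply: nonpos_sym.
Qed.
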